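(* If $P \blacktriangleright \Delta; \mathcal{C}$ and $\sigma$ is a solution for $\mathcal{C}$ that covers $\Delta$, then $\sigma\Delta \vdash P$.
   Context: **Language.** Fix a countable set of channels $a,b,c,\dots$ and a disjoint countable set of variables $x,y,\dots$; names $u$ are channels or variables. Expressions: $e,f ::= n$ (integer constants) $\mid u \mid (e,f) \mid \mathsf{fst}(e) \mid \mathsf{snd}(e) \mid \mathsf{inl}(e) \mid \mathsf{inr}(e)$. Processes: $P,Q ::= \mathsf{idle} \mid e?(x).P \mid e!f \mid P\,|\,Q \mid {*}P \mid \mathsf{new}\ a\ \mathsf{in}\ P \mid \mathsf{case}\ e\ \{i(x_i)\Rightarrow P_i\}_{i=\mathsf{inl},\mathsf{inr}}$. Input binds $x$ in $P$, $\mathsf{new}$ binds $a$ in $P$, $\mathsf{case}$ binds $x_i$ in $P_i$; processes are identified modulo renaming of bound names. **Types.** Uses $\kappa\in\{0,1,\omega\}$, with $\kappa+0=0+\kappa=\kappa$ and $\kappa_1+\kappa_2=\omega$ if both are nonzero; $2\kappa:=\kappa+\kappa$. Types $t,s$ are the possibly infinite regular trees built from the nullary constructor $\mathsf{int}$, unary constructors $[\cdot]^{\kappa_1,\kappa_2}$ (channel types), binary $\times$ and $\oplus$; type equality is equality of trees; $\odot$ stands for $\times$ or $\oplus$. Type combination $+$ is the partial binary function on types whose graph is the largest relation $\mathcal R$ such that $((t_1,t_2),s)\in\mathcal R$ implies: either $t_1=t_2=s=\mathsf{int}$; or $t_1=[t]^{\kappa_1,\kappa_2}$, $t_2=[t]^{\kappa_3,\kappa_4}$,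 $s=[t]^{\kappa_1+\kappa_3,\kappa_2+\kappa_4}$; or $t_1=t_{11}\odot t_{12}$, $t_2=t_{21}\odot t_{22}$, $s=s_1\odot s_2$ with $((t_{1i},t_{2i}),s_i)\in\mathcal R$ for $i=1,2$ (same $\odot$ throughout). $t\sim s$ (coherent) means $t+s$ is defined. A type $t$ is unlimited, $\mathsf{un}(t)$, if $t+t=t$. **Environments.** A type environment $\Gamma$ is a finite map from names to types; $\Gamma_1,\Gamma_2$ is union of environments with disjoint domains. $\Gamma_1+\Gamma_2$ is the environment with domain $\mathrm{dom}(\Gamma_1)\cup\mathrm{dom}(\Gamma_2)$ mapping $u$ to $\Gamma_1(u)+\Gamma_2(u)$ if $u$ is in both domains (undefined if some such combination is undefined) and to $\Gamma_i(u)$ if $u$ is only in $\mathrm{dom}(\Gamma_i)$. $\mathsf{un}(\Gamma)$ means all types in the range of $\Gamma$ are unlimited. **Typing of expressions** $\Gamma\vdash e:t$: $\Gamma\vdash n:\mathsf{int}$ if $\mathsf{un}(\Gamma)$; $\Gamma,u:t\vdash u:t$ if $\mathsf{un}(\Gamma)$; if $\Gamma\vdash e:t$ then $\Gamma\vdash\mathsf{inl}(e):t\oplus s$; if $\Gamma\vdash e:s$ then $\Gamma\vdash\mathsf{inr}(e):t\oplus s$; if $\Gamma_i\vdash e_i:t_i$ ($i=1,2$) then $\Gamma_1+\Gamma_2\vdash(e_1,e_2):t_1\times t_2$; if $\Gamma\vdash e:t\times s$ and $\mathsf{un}(s)$ then $\Gamma\vdash\mathsf{fst}(e):t$; if $\Gamma\vdash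 e:t\times s$ and $\mathsf{un}(t)$ then $\Gamma\vdash\mathsf{snd}(e):s$. **Typing of processes** $\Gamma\vdash P$ (combinations in conclusions are required to be defined): $\Gamma\vdash\mathsf{idle}$ if $\mathsf{un}(\Gamma)$; if $\Gamma_1\vdash e:[t]^{1+\kappa_1,2\kappa_2}$ and $\Gamma_2,x:t\vdash P$ then $\Gamma_1+\Gamma_2\vdash e?(x).P$; if $\Gamma_1\vdash e:[t]^{2\kappa_1,1+\kappa_2}$ and $\Gamma_2\vdash f:t$ then $\Gamma_1+\Gamma_2\vdash e!f$; if $\Gamma\vdash P$ and $\mathsf{un}(\Gamma)$ then $\Gamma\vdash{*}P$; if $\Gamma_i\vdash P_i$ ($i=1,2$) then $\Gamma_1+\Gamma_2\vdash P_1\,|\,P_2$; if $\Gamma,a:[t]^{\kappa,\kappa}\vdash P$ then $\Gamma\vdash\mathsf{new}\ a\ \mathsf{in}\ P$; if $\Gamma_1\vdash e:t_{\mathsf{inl}}\oplus t_{\mathsf{inr}}$ and $\Gamma_2,x_i:t_i\vdash P_i$ for $i=\mathsf{inl},\mathsf{inr}$ then $\Gamma_1+\Gamma_2\vdash\mathsf{case}\ e\ \{i(x_i)\Rightarrow P_i\}_{i=\mathsf{inl},\mathsf{inr}}$. **Type expressions and constraints.** Fix countable sets of type variables $\alpha,\beta,\dots$ and use variables $\varrho,\dots$. Use expressions: $U,V::=\varrho\mid\kappa\mid U+V$ (with $2U:=U+U$). Type expressions (finite terms): $T,S::=\alpha\mid\mathsf{int}\mid[T]^{U,V}\mid T\times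 S\mid T\oplus S$. Constraints: $T\mathrel{\hat=}S$, $T\mathrel{\hat=}S_1+S_2$, $T\mathrel{\hat\sim}S$, $U\mathrel{\hat=}V$. $\mathsf{un}(T)$ abbreviates the constraint $T\mathrel{\hat=}T+T$. $\mathcal C$ ranges over finite constraint sets. Environments $\Delta$ are finite maps from names to type expressions. **Substitutions and solutions.** A substitution $\sigma$ is a finite map from type variables to types and from use variables to uses; $\sigma T$, $\sigma U$ denote its application (computing use combinations), and $\sigma\Delta$ is pointwise application. $\sigma$ covers $T$ if its domain contains all use and type variables of $T$; it covers $\Delta$ if it covers all type expressions in the range of $\Delta$. $\sigma$ is a solution for $\mathcal C$ if it covers all expressions occurring in $\mathcal C$ and: $T\mathrel{\hat=}S\in\mathcal C$ implies $\sigma T=\sigma S$; $T\mathrel{\hat=}S_1+S_2\in\mathcal C$ implies $\sigma T=\sigma S_1+\sigma S_2$; $T\mathrel{\hat\sim}S\in\mathcal C$ implies $\sigma T\sim\sigma S$; $U\mathrel{\hat=}V\in\mathcal C$ implies $\sigma U=\sigma V$. **Environment operators.** $\Delta_1\sqcup\Delta_2\leadsto\Delta;\mathcal C$: if $\mathrm{dom}(\Delta_1)\cap\mathrm{dom}(\Delta_2)=\emptyset$ then $\Delta_1\sqcup\Delta_2\leadsto(\Delta_1,\Delta_2);\emptyset$; if $\Delta_1\sqcup\Delta_2\leadsto\Delta;\mathcal C$ and $\alpha$ is fresh then $(\Delta_1,u:T)\sqcup(\Delta_2,u:S)\leadsto(\Delta,u:\alpha);\mathcal C\cup\{\alpha\mathrel{\hat=}T+S\}$.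 $\Delta_1\sqcap\Delta_2\leadsto\Delta;\mathcal C$: $\emptyset\sqcap\emptyset\leadsto\emptyset;\emptyset$; if $\Delta_1\sqcap\Delta_2\leadsto\Delta;\mathcal C$ then $(\Delta_1,u:T)\sqcap(\Delta_2,u:S)\leadsto(\Delta,u:T);\mathcal C\cup\{T\mathrel{\hat=}S\}$. **Constraint generation** (all type/use variables introduced by a rule are fresh). Expressions, $e:T\blacktriangleright\Delta;\mathcal C$: $n:\mathsf{int}\blacktriangleright\emptyset;\emptyset$; $u:\alpha\blacktriangleright u:\alpha;\emptyset$; if $e:T\blacktriangleright\Delta;\mathcal C$ then $\mathsf{inl}(e):T\oplus\alpha\blacktriangleright\Delta;\mathcal C$, $\mathsf{inr}(e):\alpha\oplus T\blacktriangleright\Delta;\mathcal C$, $\mathsf{fst}(e):\alpha\blacktriangleright\Delta;\mathcal C\cup\{T\mathrel{\hat=}\alpha\times\beta,\mathsf{un}(\beta)\}$, $\mathsf{snd}(e):\beta\blacktriangleright\Delta;\mathcal C\cup\{T\mathrel{\hat=}\alpha\times\beta,\mathsf{un}(\alpha)\}$; if $e_i:T_i\blacktriangleright\Delta_i;\mathcal C_i$ ($i=1,2$) and $\Delta_1\sqcup\Delta_2\leadsto\Delta;\mathcal C_3$ then $(e_1,e_2):T_1\times T_2\blacktriangleright\Delta;\mathcal C_1\cup\mathcal C_2\cup\mathcal C_3$. Processes, $P\blacktriangleright\Delta;\mathcal C$: - $\mathsf{idle}\blacktriangleright\emptyset;\emptyset$. - If $e:T\blacktriangleright\Delta_1;\mathcal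 C_1$, $P\blacktriangleright\Delta_2,x:S;\mathcal C_2$, $\Delta_1\sqcup\Delta_2\leadsto\Delta;\mathcal C_3$ then $e?(x).P\blacktriangleright\Delta;\mathcal C_1\cup\mathcal C_2\cup\mathcal C_3\cup\{T\mathrel{\hat=}[S]^{1+\varrho_1,2\varrho_2}\}$. - If $e:T\blacktriangleright\Delta_1;\mathcal C_1$, $f:S\blacktriangleright\Delta_2;\mathcal C_2$, $\Delta_1\sqcup\Delta_2\leadsto\Delta;\mathcal C_3$ then $e!f\blacktriangleright\Delta;\mathcal C_1\cup\mathcal C_2\cup\mathcal C_3\cup\{T\mathrel{\hat=}[S]^{2\varrho_1,1+\varrho_2}\}$. - If $P\blacktriangleright\Delta;\mathcal C$ and $\Delta\sqcup\Delta\leadsto\Delta';\mathcal C'$ then ${*}P\blacktriangleright\Delta';\mathcal C\cup\mathcal C'$. - If $P_i\blacktriangleright\Delta_i;\mathcal C_i$ ($i=1,2$) and $\Delta_1\sqcup\Delta_2\leadsto\Delta;\mathcal C_3$ then $P_1\,|\,P_2\blacktriangleright\Delta;\mathcal C_1\cup\mathcal C_2\cup\mathcal C_3$. - If $P\blacktriangleright\Delta,a:T;\mathcal C$ then $\mathsf{new}\ a\ \mathsf{in}\ P\blacktriangleright\Delta;\mathcal C\cup\{T\mathrel{\hat=}[\alpha]^{\varrho,\varrho}\}$. - If $e:T\blacktriangleright\Delta_1;\mathcal C_1$, $P_i\blacktriangleright\Delta_i,x_i:T_i;\mathcal C_i$ ($i=\mathsf{inl},\mathsf{inr}$), $\Delta_{\mathsf{inl}}\sqcap\Delta_{\mathsf{inr}}\leadsto\Delta_2;\mathcal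 C_2$, $\Delta_1\sqcup\Delta_2\leadsto\Delta;\mathcal C_3$ then $\mathsf{case}\ e\ \{i(x_i)\Rightarrow P_i\}_{i=\mathsf{inl},\mathsf{inr}}\blacktriangleright\Delta;\mathcal C_1\cup\mathcal C_2\cup\mathcal C_3\cup\mathcal C_{\mathsf{inl}}\cup\mathcal C_{\mathsf{inr}}\cup\{T\mathrel{\hat=}T_{\mathsf{inl}}\oplus T_{\mathsf{inr}}\}$. - (weakening) If $P\blacktriangleright\Delta;\mathcal C$ then $P\blacktriangleright\Delta,u:\alpha;\mathcal C\cup\{\mathsf{un}(\alpha)\}$. *)

(* Defs.v *)
From HB Require Import structures.
From mathcomp Require Import all_boot.
From mathcomp Require Import ssralg ssrint.
From mathcomp Require Import finmap.
From Stdlib Require FunctionalExtensionality ProofIrrelevance.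

Set Implicit Arguments.
Unset Strict Implicit.
Unset Printing Implicit Defensive.

Local Open Scope fset_scope.
Local Open Scope fmap_scope.

Inductive name := Chan of nat | Var of nat.

Definition name_code (u : name) : nat + nat :=
  match u with Chan a => inl a | Var x => inr x end.
Definition name_decode (c : nat + nat) : name :=
  match c with inl a => Chan a | inr x => Var x end.
Lemma name_codeK : cancel name_code name_decode.
Proof. by case. Qed.
HB.instance Definition _ := Choice.copy name (can_type name_codeK).

Inductive expr :=
| Const of int
| Name of name
| Pair of expr & expr
| Fst of expr
| Snd of expr
| Inl of expr
| Inr of expr.

(* [Input e x P] is e?(x).P and binds the variable [Var x]; [New a P] binds
   the channel [Chan a]; [Case e x P y Q] is
   case e { inl(x) => P, inr(y) => Q }. *)
Inductive proc :=
| Idle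
| Input of expr & nat & proc
| Output of expr & expr
| Par of proc & proc
| Repl of proc
| New of nat & proc
| Case of expr & nat & proc & nat & proc.

Fixpoint fn_expr (e : expr) : {fset name} :=
  match e with
  | Const _ => fset0
  | Name u => [fset u]
  | Pair e f => fn_expr e `|` fn_expr f
  | Fst e | Snd e | Inl e | Inr e => fn_expr e
  end.

Fixpoint fn (P : proc) : {fset name} :=
  match P with
  | Idle => fset0
  | Input e x P => fn_expr e `|` (fn P `\ Var x)
  | Output e f => fn_expr e `|` fn_expr f
  | Par P Q => fn P `|` fn Q
  | Repl P => fn P
  | New a P => fn P `\ Chan a
  | Case e x P y Q => fn_expr e `|` (fn P `\ Var x) `|` (fn Q `\ Var y)
  end.

(* [ren_expr] and [ren] rename all occurrences of channels (by [f]) and of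
   variables (by [g]), binding occurrences included; they are only applied to
   transpositions, for which no capture can arise. *)
Definition ren_name (f g : nat -> nat) (u : name) : name :=
  match u with Chan a => Chan (f a) | Var x => Var (g x) end.

Fixpoint ren_expr (f g : nat -> nat) (e : expr) : expr :=
  match e with
  | Const n => Const n
  | Name u => Name (ren_name f g u)
  | Pair e1 e2 => Pair (ren_expr f g e1) (ren_expr f g e2)
  | Fst e => Fst (ren_expr f g e)
  | Snd e => Snd (ren_expr f g e)
  | Inl e => Inl (ren_expr f g e)
  | Inr e => Inr (ren_expr f g e)
  end.

Fixpoint ren (f g : nat -> nat) (P : proc) : proc :=
  match P with
  | Idle => Idle
  | Input e x P => Input (ren_expr f g e) (g x) (ren f g P)
  | Output e1 e2 => Output (ren_expr f g e1) (ren_expr f g e2)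
  | Par P Q => Par (ren f g P) (ren f g Q)
  | Repl P => Repl (ren f g P)
  | New a P => New (f a) (ren f g P)
  | Case e x P y Q =>
      Case (ren_expr f g e) (g x) (ren f g P) (g y) (ren f g Q)
  end.

Definition swap (i j k : nat) : nat :=
  if k == i then j else if k == j then i else k.
Definition swap_chan (a b : nat) : proc -> proc := ren (swap a b) id.
Definition swap_var (x y : nat) : proc -> proc := ren id (swap x y).

Inductive alpha : proc -> proc -> Prop :=
| alpha_refl P : alpha P P
| alpha_sym P Q : alpha P Q -> alpha Q P
| alpha_trans P Q R : alpha P Q -> alpha Q R -> alpha P R
| alpha_input e x P P' :
    alpha P P' -> alpha (Input e x P) (Input e x P')
| alpha_par P P' Q Q' :
    alpha P P' -> alpha Q Q' -> alpha (Par P Q) (Par P' Q')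
| alpha_repl P P' : alpha P P' -> alpha (Repl P) (Repl P')
| alpha_new a P P' : alpha P P' -> alpha (New a P) (New a P')
| alpha_case e x P P' y Q Q' :
    alpha P P' -> alpha Q Q' -> alpha (Case e x P y Q) (Case e x P' y Q')
| alpha_ren_input e x y P :
    Var y \notin fn P ->
    alpha (Input e x P) (Input e y (swap_var x y P))
| alpha_ren_new a b P :
    Chan b \notin fn P ->
    alpha (New a P) (New b (swap_chan a b P))
| alpha_ren_inl e x x' P y Q :
    Var x' \notin fn P ->
    alpha (Case e x P y Q) (Case e x' (swap_var x x' P) y Q)
| alpha_ren_inr e x P y y' Q :
    Var y' \notin fn Q ->
    alpha (Case e x P y Q) (Case e x P y' (swap_var y y' Q)).

Inductive use := Zero | One | Omega.

Definition use_add (k1 k2 : use) : use :=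
  match k1, k2 with
  | Zero, k | k, Zero => k
  | _, _ => Omega
  end.
Definition use_double (k : use) : use := use_add k k.

Inductive label := LInt | LChan of use & use | LProd | LSum.

Definition arity (l : label) : nat :=
  match l with LInt => 0 | LChan _ _ => 1 | LProd | LSum => 2 end.

(* A possibly infinite tree is a partial map from positions (sequences of child
   indices, starting from the root) to labels. *)
Definition tree := seq nat -> option label.

Definition subtree (t : tree) (p : seq nat) : tree := fun q => t (p ++ q).

Definition wf_tree (t : tree) : Prop :=
  t [::] /\
  forall p i, isSome (t (rcons p i)) = oapp (fun l => i < arity l) false (t p).

Definition regular (t : tree) : Prop :=
  exists (I : finType) (s : I -> tree),
    forall p, t p -> exists i, subtree t p =1 s i.

Record ty := Ty {
  tree_of :> tree;
  ty_wf : wf_tree tree_of;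
  ty_regular : regular tree_of }.

Lemma ty_eq (t s : ty) : tree_of t =1 tree_of s -> t = s.
Proof.
case: t s => [t tw tr] [s sw sr] /= ts.
have E : t = s by apply: FunctionalExtensionality.functional_extensionality.
subst s; congr Ty; exact: ProofIrrelevance.proof_irrelevance.
Qed.

Definition tree_node (l : label) (ts : seq tree) : tree :=
  fun p => if p is i :: q then nth (fun=> None) ts i q else Some l.

Lemma tree_node_wf l (ts : seq ty) :
  size ts = arity l -> wf_tree (tree_node l (map tree_of ts)).
Proof.
move=> sz; split=> // -[|j p] i /=.
  case: (ltnP i (arity l)) => [lt_i | le_i].
    case: ts sz lt_i => [<- //|t ts] sz lt_i.
    rewrite (nth_map t) ?sz //.
    by case: (ty_wf (nth t (t :: ts) i)).
  by rewrite nth_default // size_map sz.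
case: (ltnP j (arity l)) => [lt_j | le_j].
  case: ts sz lt_j => [<- //|t ts] sz lt_j.
  rewrite (nth_map t) ?sz //.
  by case: (ty_wf (nth t (t :: ts) j)) => _; apply.
by rewrite nth_default // size_map sz.
Qed.

Lemma tree_node_regular l (ts : seq ty) :
  regular (tree_node l (map tree_of ts)).
Proof.
have [I [s Hs]] : exists (I : finType) (s : I -> tree), forall j p,
    nth (fun=> None) (map tree_of ts) j p ->
    exists i, subtree (nth (fun=> None) (map tree_of ts) j) p =1 s i.
  elim: ts => [|t ts [I [s Hs]]].
    by exists void, (fun=> fun=> None) => j p; rewrite nth_nil.
  have [J [r Hr]] := ty_regular t.
  exists (J + I)%type, (fun k => match k with inl j => r j | inr i => s i end).
  case=> [|j] p /= Hp.
    by have [i Hi] := Hr p Hp; exists (inl i).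
  by have [i Hi] := Hs j p Hp; exists (inr i).
exists (option I),
  (fun k => if k is Some i then s i else tree_node l (map tree_of ts)).
case=> [|j p] /= Hp; first by exists None.
by have [i Hi] := Hs j p Hp; exists (Some i).
Qed.

Definition node (l : label) (ts : seq ty) (sz : size ts = arity l) : ty :=
  Ty (tree_node_wf sz) (tree_node_regular l ts).

Definition tint : ty := @node LInt [::] erefl.
(* [tchan t k1 k2] is [t]^{k1,k2}: k1 is the input use, k2 the output use. *)
Definition tchan (t : ty) (k1 k2 : use) : ty := @node (LChan k1 k2) [:: t] erefl.
Definition tprod (t s : ty) : ty := @node LProd [:: t; s] erefl.
Definition tsum (t s : ty) : ty := @node LSum [:: t; s] erefl.

(* [comb t1 t2 s] is t1 + t2 = s. *)
CoInductive comb : ty -> ty -> ty -> Prop :=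
| comb_int : comb tint tint tint
| comb_chan t k1 k2 k3 k4 :
    comb (tchan t k1 k2) (tchan t k3 k4)
         (tchan t (use_add k1 k3) (use_add k2 k4))
| comb_prod t11 t12 t21 t22 s1 s2 :
    comb t11 t21 s1 -> comb t12 t22 s2 ->
    comb (tprod t11 t12) (tprod t21 t22) (tprod s1 s2)
| comb_sum t11 t12 t21 t22 s1 s2 :
    comb t11 t21 s1 -> comb t12 t22 s2 ->
    comb (tsum t11 t12) (tsum t21 t22) (tsum s1 s2).

Definition coherent (t s : ty) : Prop := exists r, comb t s r.
Definition un (t : ty) : Prop := comb t t t.

Definition env := {fmap name -> ty}.

(* [env_comb G1 G2 G] is G1 + G2 = G. *)
Definition env_comb (G1 G2 G : env) : Prop :=
  forall u, match G1.[? u], G2.[? u] with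
            | Some t1, Some t2 => exists2 t, G.[? u] = Some t & comb t1 t2 t
            | Some t, None | None, Some t => G.[? u] = Some t
            | None, None => G.[? u] = None
            end.

Definition un_env (G : env) : Prop := forall u t, G.[? u] = Some t -> un t.

Inductive typ_expr : env -> expr -> ty -> Prop :=
| typ_const G n : un_env G -> typ_expr G (Const n) tint
| typ_name (G : env) u t :
    u \notin domf G -> un_env G -> typ_expr G.[u <- t] (Name u) t
| typ_inl G e t s : typ_expr G e t -> typ_expr G (Inl e) (tsum t s)
| typ_inr G e t s : typ_expr G e s -> typ_expr G (Inr e) (tsum t s)
| typ_pair G1 G2 G e1 e2 t1 t2 :
    typ_expr G1 e1 t1 -> typ_expr G2 e2 t2 -> env_comb G1 G2 G ->
    typ_expr G (Pair e1 e2) (tprod t1 t2)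
| typ_fst G e t s : typ_expr G e (tprod t s) -> un s -> typ_expr G (Fst e) t
| typ_snd G e t s : typ_expr G e (tprod t s) -> un t -> typ_expr G (Snd e) s.

(* Rule [typ_alpha] accounts for the identification of processes up to renaming
   of bound names. *)
Inductive typ_proc : env -> proc -> Prop :=
| typ_idle G : un_env G -> typ_proc G Idle
| typ_input (G1 G2 G : env) e x P t k1 k2 :
    typ_expr G1 e (tchan t (use_add One k1) (use_double k2)) ->
    Var x \notin domf G2 -> typ_proc G2.[Var x <- t] P ->
    env_comb G1 G2 G ->
    typ_proc G (Input e x P)
| typ_output G1 G2 G e f t k1 k2 :
    typ_expr G1 e (tchan t (use_double k1) (use_add One k2)) ->
    typ_expr G2 f t ->
    env_comb G1 G2 G ->
    typ_proc G (Output e f)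
| typ_repl G P : typ_proc G P -> un_env G -> typ_proc G (Repl P)
| typ_par G1 G2 G P1 P2 :
    typ_proc G1 P1 -> typ_proc G2 P2 -> env_comb G1 G2 G ->
    typ_proc G (Par P1 P2)
| typ_new (G : env) a P t k :
    Chan a \notin domf G -> typ_proc G.[Chan a <- tchan t k k] P ->
    typ_proc G (New a P)
| typ_case (G1 G2 G : env) e x P y Q t s :
    typ_expr G1 e (tsum t s) ->
    Var x \notin domf G2 -> typ_proc G2.[Var x <- t] P ->
    Var y \notin domf G2 -> typ_proc G2.[Var y <- s] Q ->
    env_comb G1 G2 G ->
    typ_proc G (Case e x P y Q)
| typ_alpha G P Q : typ_proc G P -> alpha P Q -> typ_proc G Q.

Inductive uexpr := UVar of nat | UConst of use | UAdd of uexpr & uexpr.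

Inductive texpr :=
| TVar of nat
| TInt
| TChan of texpr & uexpr & uexpr
| TProd of texpr & texpr
| TSum of texpr & texpr.

Inductive constr :=
| CEq of texpr & texpr
| CAdd of texpr & texpr & texpr   (* T = S1 + S2 *)
| CCoh of texpr & texpr
| CUse of uexpr & uexpr.

Definition UDouble (U : uexpr) : uexpr := UAdd U U.
Definition CUn (T : texpr) : constr := CAdd T T T.

(* Choice structures, needed to form the type [{fset constr}]. *)
Definition use_code (k : use) : nat :=
  match k with Zero => 0 | One => 1 | Omega => 2 end.
Definition use_decode (n : nat) : use :=
  match n with 0 => Zero | 1 => One | _ => Omega end.
Lemma use_codeK : cancel use_code use_decode.
Proof. by case. Qed.
HB.instance Definition _ := Choice.copy use (can_type use_codeK).

Fixpoint uexpr_code (U : uexpr) : GenTree.tree nat :=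
  match U with
  | UVar r => GenTree.Node 0 [:: GenTree.Leaf r]
  | UConst k => GenTree.Node 1 [:: GenTree.Leaf (use_code k)]
  | UAdd U V => GenTree.Node 2 [:: uexpr_code U; uexpr_code V]
  end.
Fixpoint uexpr_decode (c : GenTree.tree nat) : uexpr :=
  match c with
  | GenTree.Node 0 [:: GenTree.Leaf r] => UVar r
  | GenTree.Node 1 [:: GenTree.Leaf k] => UConst (use_decode k)
  | GenTree.Node 2 [:: c; d] => UAdd (uexpr_decode c) (uexpr_decode d)
  | _ => UConst Zero
  end.
Lemma uexpr_codeK : cancel uexpr_code uexpr_decode.
Proof. by elim=> [//|k|U IHU V IHV] /=; rewrite ?use_codeK ?IHU ?IHV. Qed.
HB.instance Definition _ := Choice.copy uexpr (can_type uexpr_codeK).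

Fixpoint texpr_code (T : texpr) : GenTree.tree (nat + uexpr) :=
  match T with
  | TVar a => GenTree.Node 0 [:: GenTree.Leaf (inl a)]
  | TInt => GenTree.Node 1 [::]
  | TChan T U V =>
      GenTree.Node 2
        [:: texpr_code T; GenTree.Leaf (inr U); GenTree.Leaf (inr V)]
  | TProd T1 T2 => GenTree.Node 3 [:: texpr_code T1; texpr_code T2]
  | TSum T1 T2 => GenTree.Node 4 [:: texpr_code T1; texpr_code T2]
  end.
Fixpoint texpr_decode (c : GenTree.tree (nat + uexpr)) : texpr :=
  match c with
  | GenTree.Node 0 [:: GenTree.Leaf (inl a)] => TVar a
  | GenTree.Node 2 [:: c; GenTree.Leaf (inr U); GenTree.Leaf (inr V)] =>
      TChan (texpr_decode c) U V
  | GenTree.Node 3 [:: c; d] => TProd (texpr_decode c) (texpr_decode d)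
  | GenTree.Node 4 [:: c; d] => TSum (texpr_decode c) (texpr_decode d)
  | _ => TInt
  end.
Lemma texpr_codeK : cancel texpr_code texpr_decode.
Proof. by elim=> [||T + U V|T + T2 +|T + T2 +] /= => [||->|-> ->|-> ->]. Qed.
HB.instance Definition _ := Choice.copy texpr (can_type texpr_codeK).

Definition constr_code (c : constr) :
    (texpr * texpr + texpr * texpr * texpr) + (texpr * texpr + uexpr * uexpr) :=
  match c with
  | CEq T1 T2 => inl (inl (T1, T2))
  | CAdd T1 S1 S2 => inl (inr (T1, S1, S2))
  | CCoh T1 T2 => inr (inl (T1, T2))
  | CUse U V => inr (inr (U, V))
  end.
Definition constr_decode
    (c : (texpr * texpr + texpr * texpr * texpr) +
         (texpr * texpr + uexpr * uexpr)) : constr :=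
  match c with
  | inl (inl (T1, T2)) => CEq T1 T2
  | inl (inr (T1, S1, S2)) => CAdd T1 S1 S2
  | inr (inl (T1, T2)) => CCoh T1 T2
  | inr (inr (U, V)) => CUse U V
  end.
Lemma constr_codeK : cancel constr_code constr_decode.
Proof. by case. Qed.
HB.instance Definition _ := Choice.copy constr (can_type constr_codeK).

Definition constrs := {fset constr}.
Definition tenv := {fmap name -> texpr}.

Record subst := Subst {
  sub_ty : {fmap nat -> ty};
  sub_use : {fmap nat -> use} }.

(* Outside the domain of the substitution, [app_u] and [app_t] return arbitrary
   values; they are only used on expressions covered by it. *)
Fixpoint app_u (s : subst) (U : uexpr) : use :=
  match U with
  | UVar r => odflt Zero (sub_use s).[? r]
  | UConst k => k
  | UAdd U V => use_add (app_u s U) (app_u s V)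
  end.

Fixpoint app_t (s : subst) (T : texpr) : ty :=
  match T with
  | TVar a => odflt tint (sub_ty s).[? a]
  | TInt => tint
  | TChan T U V => tchan (app_t s T) (app_u s U) (app_u s V)
  | TProd T1 T2 => tprod (app_t s T1) (app_t s T2)
  | TSum T1 T2 => tsum (app_t s T1) (app_t s T2)
  end.

Definition app_env (s : subst) (D : tenv) : env :=
  [fmap u : domf D => app_t s (D u)].

Fixpoint uvars_u (U : uexpr) : {fset nat} :=
  match U with
  | UVar r => [fset r]
  | UConst _ => fset0
  | UAdd U V => uvars_u U `|` uvars_u V
  end.

Fixpoint uvars (T : texpr) : {fset nat} :=
  match T with
  | TVar _ | TInt => fset0
  | TChan T U V => uvars T `|` uvars_u U `|` uvars_u V
  | TProd T1 T2 | TSum T1 T2 => uvars T1 `|` uvars T2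
  end.

Fixpoint tvars (T : texpr) : {fset nat} :=
  match T with
  | TVar a => [fset a]
  | TInt => fset0
  | TChan T _ _ => tvars T
  | TProd T1 T2 | TSum T1 T2 => tvars T1 `|` tvars T2
  end.

Definition covers_u (s : subst) (U : uexpr) : Prop :=
  uvars_u U `<=` domf (sub_use s).
Definition covers (s : subst) (T : texpr) : Prop :=
  tvars T `<=` domf (sub_ty s) /\ uvars T `<=` domf (sub_use s).
Definition covers_env (s : subst) (D : tenv) : Prop :=
  forall u T, D.[? u] = Some T -> covers s T.

Definition covers_constr (s : subst) (c : constr) : Prop :=
  match c with
  | CEq T1 T2 | CCoh T1 T2 => covers s T1 /\ covers s T2
  | CAdd T1 S1 S2 => [/\ covers s T1, covers s S1 & covers s S2]
  | CUse U V => covers_u s U /\ covers_u s V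
  end.

Definition sat (s : subst) (c : constr) : Prop :=
  match c with
  | CEq T1 T2 => app_t s T1 = app_t s T2
  | CAdd T1 S1 S2 => comb (app_t s S1) (app_t s S2) (app_t s T1)
  | CCoh T1 T2 => coherent (app_t s T1) (app_t s T2)
  | CUse U V => app_u s U = app_u s V
  end.

Definition solution (s : subst) (C : constrs) : Prop :=
  forall c, c \in C -> covers_constr s c /\ sat s c.

(* The relations below carry the list [X] of all the type variables ([inl]) and
   use variables ([inr]) introduced along a derivation. The freshness
   conditions of all rules amount to [uniq X] at the root of the derivation
   (see [generates]): every variable is then introduced exactly once, hence is
   distinct from all those coming from the other premises. *)
Definition introduced := seq (nat + nat).

(* [tenv_join X D1 D2 D C] and [tenv_meet D1 D2 D C] are the operators
   D1 |_| D2 ~> D; C and D1 |-| D2 ~> D; C. *)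
Inductive tenv_join : introduced -> tenv -> tenv -> tenv -> constrs -> Prop :=
| join_disjoint (D1 D2 : tenv) :
    [disjoint domf D1 & domf D2] -> tenv_join [::] D1 D2 (D1 + D2) fset0
| join_common X (D1 D2 D : tenv) C u T S a :
    tenv_join X D1 D2 D C ->
    u \notin domf D1 -> u \notin domf D2 ->
    tenv_join (X ++ [:: inl a])
      D1.[u <- T] D2.[u <- S] D.[u <- TVar a] (C `|` [fset CAdd (TVar a) T S]).

Inductive tenv_meet : tenv -> tenv -> tenv -> constrs -> Prop :=
| meet_empty : tenv_meet [fmap] [fmap] [fmap] fset0
| meet_common (D1 D2 D : tenv) C u T S :
    tenv_meet D1 D2 D C ->
    u \notin domf D1 -> u \notin domf D2 ->
    tenv_meet D1.[u <- T] D2.[u <- S] D.[u <- T] (C `|` [fset CEq T S]).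

Inductive gen_expr : introduced -> expr -> texpr -> tenv -> constrs -> Prop :=
| gen_const n : gen_expr [::] (Const n) TInt [fmap] fset0
| gen_name u a :
    gen_expr [:: inl a] (Name u) (TVar a) [fmap].[u <- TVar a] fset0
| gen_inl X e T D C a :
    gen_expr X e T D C ->
    gen_expr (X ++ [:: inl a]) (Inl e) (TSum T (TVar a)) D C
| gen_inr X e T D C a :
    gen_expr X e T D C ->
    gen_expr (X ++ [:: inl a]) (Inr e) (TSum (TVar a) T) D C
| gen_pair X1 X2 X3 e1 e2 T1 T2 D1 D2 D C1 C2 C3 :
    gen_expr X1 e1 T1 D1 C1 -> gen_expr X2 e2 T2 D2 C2 ->
    tenv_join X3 D1 D2 D C3 ->
    gen_expr (X1 ++ X2 ++ X3) (Pair e1 e2) (TProd T1 T2) D (C1 `|` C2 `|` C3)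
| gen_fst X e T D C a b :
    gen_expr X e T D C ->
    gen_expr (X ++ [:: inl a; inl b]) (Fst e) (TVar a) D
      (C `|` [fset CEq T (TProd (TVar a) (TVar b)); CUn (TVar b)])
| gen_snd X e T D C a b :
    gen_expr X e T D C ->
    gen_expr (X ++ [:: inl a; inl b]) (Snd e) (TVar b) D
      (C `|` [fset CEq T (TProd (TVar a) (TVar b)); CUn (TVar a)]).

(* As for typing, [gen_alpha] accounts for the identification of processes up to
   renaming of bound names. *)
Inductive gen_proc : introduced -> proc -> tenv -> constrs -> Prop :=
| gen_idle : gen_proc [::] Idle [fmap] fset0
| gen_input X1 X2 X3 e x P T S (D1 D2 D : tenv) C1 C2 C3 r1 r2 :
    gen_expr X1 e T D1 C1 ->
    Var x \notin domf D2 -> gen_proc X2 P D2.[Var x <- S] C2 ->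
    tenv_join X3 D1 D2 D C3 ->
    gen_proc (X1 ++ X2 ++ X3 ++ [:: inr r1; inr r2]) (Input e x P) D
      (C1 `|` C2 `|` C3 `|`
       [fset CEq T (TChan S (UAdd (UConst One) (UVar r1)) (UDouble (UVar r2)))])
| gen_output X1 X2 X3 e f T S D1 D2 D C1 C2 C3 r1 r2 :
    gen_expr X1 e T D1 C1 -> gen_expr X2 f S D2 C2 ->
    tenv_join X3 D1 D2 D C3 ->
    gen_proc (X1 ++ X2 ++ X3 ++ [:: inr r1; inr r2]) (Output e f) D
      (C1 `|` C2 `|` C3 `|`
       [fset CEq T (TChan S (UDouble (UVar r1)) (UAdd (UConst One) (UVar r2)))])
| gen_repl X X' P D D' C C' :
    gen_proc X P D C -> tenv_join X' D D D' C' ->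
    gen_proc (X ++ X') (Repl P) D' (C `|` C')
| gen_par X1 X2 X3 P1 P2 D1 D2 D C1 C2 C3 :
    gen_proc X1 P1 D1 C1 -> gen_proc X2 P2 D2 C2 ->
    tenv_join X3 D1 D2 D C3 ->
    gen_proc (X1 ++ X2 ++ X3) (Par P1 P2) D (C1 `|` C2 `|` C3)
| gen_new X a P T (D : tenv) C b r :
    Chan a \notin domf D -> gen_proc X P D.[Chan a <- T] C ->
    gen_proc (X ++ [:: inl b; inr r]) (New a P) D
      (C `|` [fset CEq T (TChan (TVar b) (UVar r) (UVar r))])
| gen_case X1 Xl Xr X3 e x P y Q T Tl Tr (D1 Dl Dr D2 D : tenv)
    C1 Cl Cr C2 C3 :
    gen_expr X1 e T D1 C1 ->
    Var x \notin domf Dl -> gen_proc Xl P Dl.[Var x <- Tl] Cl ->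
    Var y \notin domf Dr -> gen_proc Xr Q Dr.[Var y <- Tr] Cr ->
    tenv_meet Dl Dr D2 C2 ->
    tenv_join X3 D1 D2 D C3 ->
    gen_proc (X1 ++ Xl ++ Xr ++ X3) (Case e x P y Q) D
      (C1 `|` C2 `|` C3 `|` Cl `|` Cr `|` [fset CEq T (TSum Tl Tr)])
| gen_weak X P (D : tenv) C u a :
    gen_proc X P D C -> u \notin domf D ->
    gen_proc (X ++ [:: inl a]) P D.[u <- TVar a] (C `|` [fset CUn (TVar a)])
| gen_alpha X P Q D C : gen_proc X P D C -> alpha P Q -> gen_proc X Q D C.

Definition generates (P : proc) (D : tenv) (C : constrs) : Prop :=
  exists X, uniq X /\ gen_proc X P D C.

(* Main.v *)
(* Constraint generation follows the typing rules, except in two places.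
   Replication passes from an environment G to G + G, and weakening adds unlimited
   entries. Both are instances of one admissible rule: an entry t may be replaced
   by an unlimited T with t + T = T, and any unlimited entry may be added. (For
   replication, T = t + t works since 2k is absorbing for k and idempotent.)

   The rule is proved by induction on typing. When the environment is split as
   G1 + G2, the whole extension can be given to either side: if t1 + t2 = t,
   t + T = T and T is unlimited, then already t1 + T = T. In communications it
   goes to the subject, whose type must be a channel type, and the uses 1 + k and
   2k demanded there survive the replacement of any use by omega; payloads keep
   their types. In a case it goes to the branches. An added name may clash with a
   binder, so the induction is carried out up to a bijective renaming. *)
From mathcomp Require Import all_boot.
From mathcomp Require Import finmap.
From Stdlib Require Import IndefiniteDescription.
Require Import Defs.

Set Implicit Arguments.
Unset Strict Implicit.
Unset Printing Implicit Defensive.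

Local Open Scope fset_scope.
Local Open Scope fmap_scope.

(** * Combination of types *)

(** Types are functions on positions, so the components are recovered by evaluation: the uses at the
    root, the payload at the positions [0 :: p]. *)
Lemma tchan_inj t k1 k2 t' k1' k2' :
  tchan t k1 k2 = tchan t' k1' k2' -> [/\ t = t', k1 = k1' & k2 = k2'].
Proof.
move=> /(congr1 tree_of) E; have := congr1 (@^~ [::]) E.
case=> -> ->; split=> //; apply: ty_eq => p.
exact: (congr1 (@^~ (0 :: p)) E).
Qed.

Lemma tprod_inj t s t' s' : tprod t s = tprod t' s' -> t = t' /\ s = s'.
Proof.
move=> /(congr1 tree_of) E; split; apply: ty_eq => p.
  exact: (congr1 (@^~ (0 :: p)) E).
exact: (congr1 (@^~ (1 :: p)) E).
Qed.

Lemma tsum_inj t s t' s' : tsum t s = tsum t' s' -> t = t' /\ s = s'.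
Proof.
move=> /(congr1 tree_of) E; split; apply: ty_eq => p.
  exact: (congr1 (@^~ (0 :: p)) E).
exact: (congr1 (@^~ (1 :: p)) E).
Qed.

Variant comb_step (R : ty -> ty -> ty -> Prop) : ty -> ty -> ty -> Prop :=
| step_int : comb_step R tint tint tint
| step_chan t k1 k2 k3 k4 l1 l2 :
    l1 = use_add k1 k3 -> l2 = use_add k2 k4 ->
    comb_step R (tchan t k1 k2) (tchan t k3 k4) (tchan t l1 l2)
| step_prod t11 t12 t21 t22 s1 s2 :
    R t11 t21 s1 -> R t12 t22 s2 ->
    comb_step R (tprod t11 t12) (tprod t21 t22) (tprod s1 s2)
| step_sum t11 t12 t21 t22 s1 s2 :
    R t11 t21 s1 -> R t12 t22 s2 ->
    comb_step R (tsum t11 t12) (tsum t21 t22) (tsum s1 s2).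

(** Coinduction with an explicit invariant [R], which confines the guarded [cofix] to this proof. *)
Lemma comb_coind (R : ty -> ty -> ty -> Prop) :
  (forall t1 t2 s, R t1 t2 s -> comb_step R t1 t2 s) ->
  forall t1 t2 s, R t1 t2 s -> comb t1 t2 s.
Proof.
move=> step; cofix IH => t1 t2 s /step[].
- exact: comb_int.
- move=> t k1 k2 k3 k4 l1 l2 -> ->; exact: comb_chan.
- move=> t11 t12 t21 t22 r1 r2 /IH H1 /IH H2; exact: comb_prod.
- move=> t11 t12 t21 t22 r1 r2 /IH H1 /IH H2; exact: comb_sum.
Qed.

Lemma comb_intP t s : comb tint t s -> t = tint /\ s = tint.
Proof.
move E: tint => t0 H; case: H E => [//|? ? ? ? ?|? ? ? ? ? ? _ _|? ? ? ? ? ? _ _];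
by move=> /(congr1 (fun t => tree_of t [::])).
Qed.

Lemma comb_chanP t k1 k2 t' s : comb (tchan t k1 k2) t' s ->
  exists k3 k4, t' = tchan t k3 k4 /\
                s = tchan t (use_add k1 k3) (use_add k2 k4).
Proof.
move E: (tchan t k1 k2) => t0 H.
case: H E => [|t1 l1 l2 l3 l4|? ? ? ? ? ? _ _|? ? ? ? ? ? _ _] E;
  try by move/(congr1 (fun t => tree_of t [::])): E.
by have [-> -> ->] := tchan_inj E; exists l3, l4.
Qed.

Lemma comb_prodP t1 t2 t' s : comb (tprod t1 t2) t' s ->
  exists t1' t2' s1 s2, [/\ t' = tprod t1' t2', s = tprod s1 s2,
    comb t1 t1' s1 & comb t2 t2' s2].
Proof.
move E: (tprod t1 t2) => t0 H.
case: H E => [|? ? ? ? ?|t11 t12 t21 t22 s1 s2 H1 H2|? ? ? ? ? ? _ _] E;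
  try by move/(congr1 (fun t => tree_of t [::])): E.
by have [-> ->] := tprod_inj E; exists t21, t22, s1, s2.
Qed.

Lemma comb_sumP t1 t2 t' s : comb (tsum t1 t2) t' s ->
  exists t1' t2' s1 s2, [/\ t' = tsum t1' t2', s = tsum s1 s2,
    comb t1 t1' s1 & comb t2 t2' s2].
Proof.
move E: (tsum t1 t2) => t0 H.
case: H E => [|? ? ? ? ?|? ? ? ? ? ? _ _|t11 t12 t21 t22 s1 s2 H1 H2] E;
  try by move/(congr1 (fun t => tree_of t [::])): E.
by have [-> ->] := tsum_inj E; exists t21, t22, s1, s2.
Qed.

Lemma comb_sym t1 t2 s : comb t1 t2 s -> comb t2 t1 s.
Proof.
apply: (@comb_coind (fun t1 t2 s => comb t2 t1 s)) => {}t1 {}t2 {}s.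
case=> [|t k1 k2 k3 k4|? ? ? ? ? ? H1 H2|? ? ? ? ? ? H1 H2].
- exact: step_int.
- by apply: step_chan; [case: k1; case: k3|case: k2; case: k4].
- exact: step_prod.
- exact: step_sum.
Qed.

Lemma un_prod t s : un (tprod t s) <-> un t /\ un s.
Proof.
split=> [/comb_prodP[t1 [t2 [s1 [s2 [/tprod_inj[<- <-] /tprod_inj[<- <-]]]]]]//|].
by case; apply: comb_prod.
Qed.

Lemma un_sum t s : un (tsum t s) <-> un t /\ un s.
Proof.
split=> [/comb_sumP[t1 [t2 [s1 [s2 [/tsum_inj[<- <-] /tsum_inj[<- <-]]]]]]//|].
by case; apply: comb_sum.
Qed.

(** On a channel type the payload is kept, and each use of [T] is [Omega], or [Zero] where that of
    [t] is [Zero]. *)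
Definition absorb (t T : ty) : Prop := comb t T T /\ un T.

(** On uses, [k + 2k = 2k] and [2k + 2k = 2k]; coinduction lifts both to types. *)
Lemma comb_double t s : comb t t s -> absorb t s.
Proof.
move=> ts; split.
  apply: (@comb_coind (fun t s s' => comb t t s /\ s = s')); last by [].
  (* The second copy of [t] becomes a variable for the case analysis; injectivity of the type
     constructors identifies the components again. *)
  move=> {ts}t {}s _ [+ <-]; move E: {2}t => t' H.
  case: H E => [|t0 k1 k2 k3 k4|? ? ? ? ? ? H1 H2|? ? ? ? ? ? H1 H2] E.
  - exact: step_int.
  - have [_ <- <-] := tchan_inj E.
    by apply: step_chan; [case: (k1)|case: (k2)].
  - have [E1 E2] := tprod_inj E; rewrite -E1 in H1; rewrite -E2 in H2.
    exact: step_prod.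
  - have [E1 E2] := tsum_inj E; rewrite -E1 in H1; rewrite -E2 in H2.
    exact: step_sum.
(* The invariant says that [s] is a double: its components are then doubles of the components of
   [t]. *)
apply: (@comb_coind (fun s s' s'' =>
  exists2 t, comb t t s & s = s' /\ s = s'')); last by exists t.
move=> {ts}{}s _ _ [{}t + [<- <-]]; move E: {2}t => t' H.
case: H E => [|t0 k1 k2 k3 k4|t1 t2 ? ? ? ? H1 H2|t1 t2 ? ? ? ? H1 H2] E.
- exact: step_int.
- have [_ <- <-] := tchan_inj E.
  by apply: step_chan; [case: (k1)|case: (k2)].
- have [E1 E2] := tprod_inj E; rewrite -E1 in H1; rewrite -E2 in H2.
  by apply: step_prod; [exists t1|exists t2].
- have [E1 E2] := tsum_inj E; rewrite -E1 in H1; rewrite -E2 in H2.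
  by apply: step_sum; [exists t1|exists t2].
Qed.

(** On uses, an idempotent [l] absorbing [k1 + k3] is [Omega], or is [Zero] with both summands
    [Zero]; either way it absorbs [k1]. *)
Lemma absorb_split t1 t2 t T : comb t1 t2 t -> absorb t T -> absorb t1 T.
Proof.
move=> H [HT uT]; split=> //.
apply: (@comb_coind (fun t1 T T' =>
  T = T' /\ exists t2 t, [/\ comb t1 t2 t, comb t T T & un T])); last first.
  by split=> //; exists t2, t.
move=> {H HT uT}{}t1 {}T _ [<- [{}t2 [{}t [H + +]]]].
case: H => [|t0 k1 k2 k3 k4|t11 t12 t21 t22 s1 s2 H1 H2|t11 t12 t21 t22 s1 s2 H1 H2].
- move=> /comb_intP[-> _] _; exact: step_int.
- case/comb_chanP=> [l1 [l2 [-> /tchan_inj[_ E1 E2]]]].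
  case/comb_chanP=> [_ [_ [/tchan_inj[_ <- <-] /tchan_inj[_ E3 E4]]]].
  apply: step_chan.
    by move: E1 E3; case: (k1); case: (k3); case: (l1).
  by move: E2 E4; case: (k2); case: (k4); case: (l2).
- case/comb_prodP=> [T1 [T2 [_ [_ [-> /tprod_inj[<- <-] HT1 HT2]]]]].
  case/un_prod=> u1 u2; apply: step_prod.
    by split=> //; exists t21, s1.
  by split=> //; exists t22, s2.
- case/comb_sumP=> [T1 [T2 [_ [_ [-> /tsum_inj[<- <-] HT1 HT2]]]]].
  case/un_sum=> u1 u2; apply: step_sum.
    by split=> //; exists t21, s1.
  by split=> //; exists t22, s2.
Qed.

(** * Extension of environments *)

(** The bound [D] on the names with an entry turns a pointwise choice into a finite map. *)
Lemma env_choice (D : {fset name}) (R : name -> option ty -> Prop) :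
  (forall u, exists2 o, R u o & isSome o -> u \in D) ->
  exists G : env, forall u, R u G.[? u].
Proof.
move=> RP.
have /functional_choice[h hP] :
    forall u, exists o, R u o /\ (isSome o -> u \in D).
  by move=> u; have [o] := RP u; exists o.
(* [reducef] drops the names of [D] at which the choice is [None]. *)
exists (reducef [fmap u : D => h (val u)]) => u; have [Ru hD] := hP u.
rewrite fnd_reducef; case: fndP => [uD|uD] /=; first by rewrite ffunE.
by case: (h u) Ru hD => // t _ /(_ isT) uD'; rewrite uD' in uD.
Qed.

(** The body of [env_comb] at one name, hence convertible with it. *)
Definition ocomb (o1 o2 o : option ty) : Prop :=
  match o1, o2 with
  | Some t1, Some t2 => exists2 t, o = Some t & comb t1 t2 t
  | Some t, None | None, Some t => o = Some t
  | None, None => o = None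
  end.

(* The entry [o] of an environment may be replaced by [o']. *)
Definition oext (o o' : option ty) : Prop :=
  match o, o' with
  | Some t, Some T => t = T \/ absorb t T
  | None, Some T => un T
  | None, None => True
  | Some _, None => False
  end.

Lemma oext_refl o : oext o o. Proof. by case: o => //= t; left. Qed.

Lemma oext_None o : oext o None -> o = None. Proof. by case: o. Qed.

Lemma oext_un o o' : (forall t, o = Some t -> un t) -> oext o o' ->
  forall T, o' = Some T -> un T.
Proof.
move=> uo + T oT; rewrite {}oT; case: o uo => //= t uo [<-|[]//].
exact: uo.
Qed.

(** All growth is charged to the first summand. The last clause supplies the finite bound required
    by [env_choice]. *)
Lemma ocomb_oext o1 o2 o o' : ocomb o1 o2 o -> oext o o' ->
  exists2 o1', oext o1 o1' /\ ocomb o1' o2 o' & isSome o1' -> isSome o'.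
Proof.
case: o1 => [t1|]; case: o2 => [t2|] /=.
- case=> t -> H; case: o' => [T|] //= [<-|tT].
    by exists (Some t1) => //; split; [left|exists t].
  exists (Some T) => //; split; first by right; apply: absorb_split tT; exact: H.
  by exists T => //; apply: comb_sym; case: (absorb_split (comb_sym H) tT).
- by move=> -> H; exists o' => //; split=> //; case: o' H.
(* If an entry owned by the second summand alone grows, the first receives a new unlimited entry
   [T], and [T + t2 = T]. *)
- move=> ->; case: o' => [T|] //= [<-|[H uT]]; first by exists None.
  by exists (Some T) => //; split=> //; exists T => //; apply: comb_sym.
- by move=> -> H; exists o' => //; split=> //; case: (o').
Qed.

Lemma ocombC o1 o2 o : ocomb o1 o2 o -> ocomb o2 o1 o.
Proof.
by case: o1 => [t1|]; case: o2 => [t2|] //= [t ? H]; exists t => //; exact: comb_sym.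
Qed.

Lemma env_combC G1 G2 G : env_comb G1 G2 G -> env_comb G2 G1 G.
Proof. by move=> H u; apply: ocombC; apply: H. Qed.

(** * Environments along a renaming *)

Lemma ren_name_inj f g : injective f -> injective g -> injective (ren_name f g).
Proof. by move=> fI gI [a|x] [b|y] //= [] => [/fI|/gI] ->. Qed.

Lemma ren_name_surj f g v : bijective f -> bijective g ->
  exists u, v = ren_name f g u.
Proof.
move=> [f' _ fK] [g' _ gK].
by case: v => [b|y]; [exists (Chan (f' b))|exists (Var (g' y))]; rewrite /= ?fK ?gK.
Qed.

Definition env_ren f g (G G' : env) : Prop :=
  forall u, G'.[? ren_name f g u] = G.[? u].

Definition env_ext f g (G G' : env) : Prop :=
  forall u, oext G.[? u] G'.[? ren_name f g u].

Lemma env_ren_ext f g G G' : env_ren f g G G' -> env_ext f g G G'.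
Proof. by move=> H u; rewrite H; apply: oext_refl. Qed.

Lemma env_ren_exists f g (G : env) : bijective f -> bijective g ->
  exists G', env_ren f g G G'.
Proof.
move=> fB gB; have rI := ren_name_inj (bij_inj fB) (bij_inj gB).
(* By injectivity at most one [u] qualifies for a given [v], so no inverse renaming has to be
   defined. *)
pose R v o := forall u, v = ren_name f g u -> o = G.[? u].
suff [G' G'P] : exists G' : env, forall v, R v G'.[? v].
  by exists G' => u; apply: G'P.
apply: (env_choice (D := [fset ren_name f g u | u in domf G])) => v.
have [u ->] := ren_name_surj v fB gB.
exists G.[? u]; first by move=> w /rI <-.
by rewrite fndSome => uG; apply: in_imfset.
Qed.

Lemma env_ren_set f g (G G' : env) u t : injective f -> injective g ->
  env_ren f g G G' -> env_ren f g G.[u <- t] G'.[ren_name f g u <- t].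
Proof.
move=> fI gI H v; rewrite !fnd_set H.
by rewrite (inj_eq (ren_name_inj fI gI)).
Qed.

(** The second summand is only renamed, so whatever is typed in it keeps its type exactly. *)
Lemma env_ext_comb f g G1 G2 G G' : bijective f -> bijective g ->
  env_comb G1 G2 G -> env_ext f g G G' ->
  exists G1' G2', [/\ env_ext f g G1 G1', env_ren f g G2 G2' &
                      env_comb G1' G2' G'].
Proof.
move=> fB gB cG eG.
have rI := ren_name_inj (bij_inj fB) (bij_inj gB).
have [G2' G2P] := env_ren_exists G2 fB gB.
pose R v o := forall u, v = ren_name f g u ->
  oext G1.[? u] o /\ ocomb o G2.[? u] G'.[? v].
have [G1' G1P] : exists G1' : env, forall v, R v G1'.[? v].
  apply: (env_choice (D := domf G')) => v.
  have [u ->] := ren_name_surj v fB gB.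
  have [o oP od] := ocomb_oext (cG u) (eG u).
  by exists o; [move=> w /rI <-|move=> /od; rewrite fndSome].
exists G1', G2'; split=> [u|u|v].
- by case: (G1P _ u erefl).
- by [].
- have [u E] := ren_name_surj v fB gB.
  by have [_] := G1P _ u E; rewrite E G2P.
Qed.

(** * Typing of expressions under renaming and extension *)

Lemma typ_expr_name (G : env) u t : G.[? u] = Some t ->
  (forall v T, v != u -> G.[? v] = Some T -> un T) -> typ_expr G (Name u) t.
Proof.
move=> Gu uG; have -> : G = G.[~ u].[u <- t].
  by apply/fmapP => v; rewrite fnd_set fnd_rem1; case: eqP => [->|].
apply: typ_name; first by rewrite -fndSome fnd_rem1 eqxx.
by move=> v T; rewrite fnd_rem1; case: ifP => // vu; apply: uG.
Qed.

(** Serves for output payloads and [case] scrutinees, whose types must not grow. *)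
Lemma typ_expr_ren f g G e t G' : bijective f -> bijective g ->
  typ_expr G e t -> env_ren f g G G' -> typ_expr G' (ren_expr f g e) t.
Proof.
move=> fB gB H; elim: H G' => {G e t}.
- move=> G n uG G' HG; apply: typ_const => v T.
  by have [u ->] := ren_name_surj v fB gB; rewrite HG; apply: uG.
- move=> G u t uG unG G' HG; apply: typ_expr_name.
    by rewrite HG fnd_set eqxx.
  move=> v T; have [w ->] := ren_name_surj v fB gB.
  rewrite HG fnd_set; case: (w =P u) => [->|_ _]; first by rewrite eqxx.
  exact: unG.
- by move=> G e t s _ IH G' /IH; apply: typ_inl.
- by move=> G e t s _ IH G' /IH; apply: typ_inr.
- move=> G1 G2 G e1 e2 t1 t2 _ IH1 _ IH2 cG G' HG.
  have [G1' H1] := env_ren_exists G1 fB gB.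
  have [G2' H2] := env_ren_exists G2 fB gB.
  apply: typ_pair (IH1 _ H1) (IH2 _ H2) _ => v.
  by have [u ->] := ren_name_surj v fB gB; rewrite H1 H2 HG; apply: cG.
- by move=> G e t s _ IH us G' /IH H; apply: typ_fst H us.
- by move=> G e t s _ IH ut G' /IH H; apply: typ_snd H ut.
Qed.

(** More general than equality or [absorb]: in a pair one component may be absorbed while the other
    stays linear, and the whole is then not unlimited. *)
Inductive texts : ty -> ty -> Prop :=
| texts_refl t : texts t t
| texts_absorb t T : absorb t T -> texts t T
| texts_prod t s T S : texts t T -> texts s S -> texts (tprod t s) (tprod T S)
| texts_sum t s T S : texts t T -> texts s S -> texts (tsum t s) (tsum T S).

Lemma texts_un t T : texts t T -> un t -> un T.
Proof.
elim=> {t T} [//|t T [_ uT] //|t s T S _ IH1 _ IH2|t s T S _ IH1 _ IH2].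
  by move=> /un_prod[/IH1 ? /IH2 ?]; apply/un_prod.
by move=> /un_sum[/IH1 ? /IH2 ?]; apply/un_sum.
Qed.

Lemma texts_prodP t s R : texts (tprod t s) R ->
  exists T S, [/\ R = tprod T S, texts t T & texts s S].
Proof.
move E: (tprod t s) => r H.
case: H E => [{}r <-|{}r {}R [+ uR] E|t1 s1 T S tT sS E|t1 s1 T S _ _].
- by exists t, s; split=> //; apply: texts_refl.
- rewrite -{}E => H.
  have [T [S [T' [S' [ER ER' tT sS]]]]] := comb_prodP H.
  have [ET ES] := tprod_inj (etrans (esym ER) ER').
  move: uR tT sS; rewrite ER -ET -ES => /un_prod[uT uS] tT sS.
  by exists T, S; split=> //; apply: texts_absorb.
- by have [-> ->] := tprod_inj E; exists T, S.
- by move/(congr1 (fun t => tree_of t [::])).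
Qed.

(** An idempotent use absorbing [k] is [Omega], or is [Zero] with [k = Zero]. *)
Lemma texts_chanP t k1 k2 T : texts (tchan t k1 k2) T ->
  exists l1 l2, [/\ T = tchan t l1 l2, l1 = k1 \/ l1 = Omega
                 & l2 = k2 \/ l2 = Omega].
Proof.
move E: (tchan t k1 k2) => r H.
case: H E => [{}r <-|{}r {}T [+ uT] E|? ? ? ? _ _|? ? ? ? _ _];
  try by move/(congr1 (fun t => tree_of t [::])).
  by exists k1, k2; split; auto.
rewrite -{}E => /comb_chanP[l1 [l2 [ET]]]; move: uT; rewrite {T}ET.
move=> /comb_chanP[_ [_ [/tchan_inj[_ <- <-] /tchan_inj[_ E1 E2]]]].
move=> /tchan_inj[_ E3 E4]; exists l1, l2; split=> //.
  by move: E1 E3; case: (k1); case: (l1); auto.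
by move: E2 E4; case: (k2); case: (l2); auto.
Qed.

(* The type of the expression may grow too: it is that of the name itself when
   the expression is a name. *)
Lemma typ_expr_ext f g G e t G' : bijective f -> bijective g ->
  typ_expr G e t -> env_ext f g G G' ->
  exists2 T, texts t T & typ_expr G' (ren_expr f g e) T.
Proof.
move=> fB gB H; elim: H G' => {G e t}.
- move=> G n uG G' HG; exists tint; first exact: texts_refl.
  apply: typ_const => v; have [u ->] := ren_name_surj v fB gB.
  exact: oext_un (uG u) (HG u).
- move=> G u t uG unG G' HG.
  have := HG u; rewrite fnd_set eqxx.
  case EG: G'.[? _] => [T|] //= HT; exists T.
    by case: HT => [<-|]; [apply: texts_refl|apply: texts_absorb].
  apply: typ_expr_name EG _ => v S.
  have [w ->] := ren_name_surj v fB gB => vu.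
  apply: (oext_un _ (HG w)) => s; rewrite fnd_set.
  by case: (w =P u) vu => [->|_ _]; [rewrite eqxx|apply: unG].
- move=> G e t s _ IH G' /IH[T tT H]; exists (tsum T s); last exact: typ_inl.
  by apply: texts_sum => //; apply: texts_refl.
- move=> G e t s _ IH G' /IH[T tT H]; exists (tsum t T); last exact: typ_inr.
  by apply: texts_sum => //; apply: texts_refl.
- move=> G1 G2 G e1 e2 t1 t2 _ IH1 _ IH2 cG G' HG.
  have [G1' [G2' [H1 /env_ren_ext H2 cG']]] := env_ext_comb fB gB cG HG.
  have [T1 tT1 {}H1] := IH1 _ H1; have [T2 tT2 {}H2] := IH2 _ H2.
  by exists (tprod T1 T2); [apply: texts_prod|apply: typ_pair H1 H2 cG'].
- move=> G e t s _ IH us G' /IH[_ /texts_prodP[T [S [-> tT sS]]] H].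
  by exists T => //; apply: typ_fst H (texts_un sS us).
- move=> G e t s _ IH ut G' /IH[_ /texts_prodP[T [S [-> tT sS]]] H].
  by exists S => //; apply: typ_snd H (texts_un tT ut).
Qed.

(** * Renaming *)

Lemma ren_expr_comp f g f' g' e :
  ren_expr f' g' (ren_expr f g e) = ren_expr (f' \o f) (g' \o g) e.
Proof.
elim: e => //= [u|e1 -> e2 -> //|e ->|e ->|e ->|e ->] //.
by case: u.
Qed.

Lemma ren_comp f g f' g' P :
  ren f' g' (ren f g P) = ren (f' \o f) (g' \o g) P.
Proof.
elim: P => //= [e x P ->|e1 e2|P -> Q ->|P ->|a P ->|e x P -> y Q ->] //;
by rewrite !ren_expr_comp.
Qed.

Lemma eq_ren_expr f g f' g' : f =1 f' -> g =1 g' ->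
  ren_expr f g =1 ren_expr f' g'.
Proof.
move=> Ef Eg; elim=> //= [u|e1 -> e2 -> //|e ->|e ->|e ->|e ->] //.
by case: u => [a|x] /=; rewrite ?Ef ?Eg.
Qed.

Lemma eq_ren f g f' g' : f =1 f' -> g =1 g' -> ren f g =1 ren f' g'.
Proof.
move=> Ef Eg; have E := eq_ren_expr Ef Eg.
by elim=> //= [e x P ->|e1 e2|P -> Q ->|P ->|a P ->|e x P -> y Q ->] //;
  rewrite ?E ?Ef ?Eg.
Qed.

Lemma ren_id P : ren id id P = P.
Proof.
have E e : ren_expr id id e = e.
  elim: e => //= [u|e1 -> e2 -> //|e ->|e ->|e ->|e ->] //.
  by case: u.
by elim: P => //= [e x P ->|e1 e2|P -> Q ->|P ->|a P ->|e x P -> y Q ->];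
  rewrite ?E.
Qed.

(** Conjugation of a transposition, stated without an inverse of [f]. *)
Lemma inj_swap f a b : injective f -> f \o swap a b =1 swap (f a) (f b) \o f.
Proof.
move=> fI c; rewrite /= /swap !(inj_eq fI).
by case: eqP => // _; case: eqP.
Qed.

Lemma swapK a b : involutive (swap a b).
Proof.
move=> c; rewrite /swap; case: (eqVneq c a) => [->|ca].
  by rewrite eqxx; case: eqP.
case: (eqVneq c b) => [->|cb]; first by rewrite eqxx.
by rewrite (negPf ca) (negPf cb).
Qed.

Lemma ren_swap_var f g x y P : injective g ->
  ren f g (swap_var x y P) = swap_var (g x) (g y) (ren f g P).
Proof.
by move=> gI; rewrite /swap_var !ren_comp; apply: eq_ren => //; apply: inj_swap.
Qed.

Lemma ren_swap_chan f g a b P : injective f ->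
  ren f g (swap_chan a b P) = swap_chan (f a) (f b) (ren f g P).
Proof.
by move=> fI; rewrite /swap_chan !ren_comp; apply: eq_ren => //; apply: inj_swap.
Qed.

Lemma fn_ren_expr f g e u : injective f -> injective g ->
  (ren_name f g u \in fn_expr (ren_expr f g e)) = (u \in fn_expr e).
Proof.
move=> fI gI; elim: e => //= [w|e1 IH1 e2 IH2]; last by rewrite !inE IH1 IH2.
by rewrite !inE (inj_eq (ren_name_inj fI gI)).
Qed.

(** Binders are renamed together with occurrences, so injectivity excludes capture. *)
Lemma fn_ren f g P u : injective f -> injective g ->
  (ren_name f g u \in fn (ren f g P)) = (u \in fn P).
Proof.
move=> fI gI; have rE := inj_eq (ren_name_inj fI gI).
have rV x : (ren_name f g u == Var (g x)) = (u == Var x) by rewrite -(rE u).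
have rC a : (ren_name f g u == Chan (f a)) = (u == Chan a) by rewrite -(rE u).
elim: P => //= [e x P IH|e1 e2|P IH1 Q IH2|a P IH|e x P IH1 y Q IH2];
by rewrite !inE ?fn_ren_expr // ?IH ?IH1 ?IH2 ?rV ?rC.
Qed.

Lemma alpha_ren f g P Q : injective f -> injective g ->
  alpha P Q -> alpha (ren f g P) (ren f g Q).
Proof.
move=> fI gI; elim=> {P Q} /=; try (by move=> *; constructor).
- by move=> P Q R _ H1 _ H2; apply: alpha_trans H1 H2.
- move=> e x y P yP; rewrite ren_swap_var //; apply: alpha_ren_input.
  by rewrite -[Var _]/(ren_name f g (Var y)) fn_ren.
- move=> a b P bP; rewrite ren_swap_chan //; apply: alpha_ren_new.
  by rewrite -[Chan _]/(ren_name f g (Chan b)) fn_ren.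
- move=> e x x' P y Q xP; rewrite ren_swap_var //; apply: alpha_ren_inl.
  by rewrite -[Var _]/(ren_name f g (Var x')) fn_ren.
- move=> e x P y y' Q yQ; rewrite ren_swap_var //; apply: alpha_ren_inr.
  by rewrite -[Var _]/(ren_name f g (Var y')) fn_ren.
Qed.

Lemma fresh_name (A : {fset name}) :
  exists n, Chan n \notin A /\ Var n \notin A.
Proof.
(* A threshold, unlike a single fresh index, survives the addition of one more name by taking a
   maximum. *)
suff [n nP] : exists n, forall m, n <= m -> Chan m \notin A /\ Var m \notin A.
  by exists n; apply: nP.
have : exists n, forall m, n <= m ->
    Chan m \notin enum_fset A /\ Var m \notin enum_fset A.
  elim: (enum_fset A) => [|u s [n nP]]; first by exists 0.
  exists (maxn n (match u with Chan a => a | Var x => x end).+1) => m.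
  rewrite geq_max !inE => /andP[/nP[cs vs] lt_m].
  by split; rewrite negb_or ?cs ?vs andbT; case: u lt_m => k lt_m //;
    apply: contraTneq lt_m => -[->]; rewrite ltnn.
by [].
Qed.

(* [r'] is [r] followed by the transposition of [r u] and the fresh name [v]. *)
Lemma oext_bind (r r' : name -> name) (G G' : env) u v t :
  injective r -> u \notin domf G -> v \notin domf G' ->
  (forall w, oext G.[? w] G'.[? r w]) ->
  r' u = v -> (forall w, w != u -> r' w = if r w == v then r u else r w) ->
  forall w, oext G.[u <- t].[? w] G'.[v <- t].[? r' w].
Proof.
move=> rI uG vG' HG r'u r'E w; rewrite !fnd_set.
case: (eqVneq w u) => [->|wu]; first by rewrite r'u eqxx; left.
rewrite r'E //; case: (r w =P v) => [rw|/eqP/negPf->//].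
(* Here [w] has no entry in [G], since [v] has none in [G']. Its new image is [r u], where [G'] can
   only hold an added unlimited entry because [u] is not in [G]. *)
have -> : (r u == v) = false by rewrite -rw (inj_eq rI) eq_sym (negPf wu).
have -> : G.[? w] = None by apply: oext_None; have := HG w; rewrite rw (not_fnd vG').
by have := HG u; rewrite (not_fnd uG).
Qed.

(** The image [f a] of a binder may clash with an entry added in [G']. Composing with a
    transposition redirects [a] to [b] and preserves bijectivity. *)
Lemma env_ext_bind_chan f g (G G' : env) a b t : injective f -> injective g ->
  Chan a \notin domf G -> Chan b \notin domf G' -> env_ext f g G G' ->
  env_ext (swap (f a) b \o f) g G.[Chan a <- t] G'.[Chan b <- t].
Proof.
move=> fI gI aG bG' HG; apply: (oext_bind _ (ren_name_inj fI gI)) => //=.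
  by rewrite /swap eqxx.
case=> [c|x] //=; rewrite -[Chan c == _]/(c == a) => ca.
by rewrite /swap (inj_eq fI) (negPf ca) -[Chan _ == _]/(f c == b); case: ifP.
Qed.

Lemma env_ext_bind_var f g (G G' : env) x y t : injective f -> injective g ->
  Var x \notin domf G -> Var y \notin domf G' -> env_ext f g G G' ->
  env_ext f (swap (g x) y \o g) G.[Var x <- t] G'.[Var y <- t].
Proof.
move=> fI gI xG yG' HG; apply: (oext_bind _ (ren_name_inj fI gI)) => //=.
  by rewrite /swap eqxx.
case=> [c|z] //=; rewrite -[Var z == _]/(z == x) => zx.
by rewrite /swap (inj_eq gI) (negPf zx) -[Var _ == _]/(g z == y); case: ifP.
Qed.

(** [Omega] is its own double, so a grown use still has the required form. *)
Lemma use_ext_double k l : l = use_double k \/ l = Omega ->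
  exists k', l = use_double k'.
Proof. by case=> ->; [exists k|exists Omega]. Qed.

Lemma use_ext_one k l : l = use_add One k \/ l = Omega ->
  exists k', l = use_add One k'.
Proof. by case=> ->; [exists k|exists Omega]. Qed.

(** Surjectivity makes every name of [G'] an image, so [env_ext] also forces the added entries to be
    unlimited. *)
Lemma typ_proc_ext f g G P G' : bijective f -> bijective g ->
  typ_proc G P -> env_ext f g G G' -> typ_proc G' (ren f g P).
Proof.
move=> + + H; elim: H f g G' => {G P}.
- move=> G uG f g G' fB gB HG; apply: typ_idle => v.
  have [u ->] := ren_name_surj v fB gB; exact: oext_un (uG u) (HG u).
- move=> G1 G2 G e x P t k1 k2 He xG2 _ IH cG f g G' fB gB HG.
  have [G1' [G2' [H1 H2 cG']]] := env_ext_comb fB gB cG HG.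
  (* The payload [t] is unchanged, so the continuation keeps the type of its bound variable. *)
  have [_ /texts_chanP[l1 [l2 [-> Hl1 Hl2]]] {}He] := typ_expr_ext fB gB He H1.
  have [k1' E1] := use_ext_one Hl1; have [k2' E2] := use_ext_double Hl2.
  rewrite E1 E2 in He.
  apply: typ_input He _ _ cG'.
    by rewrite -[Var _]/(ren_name f g (Var x)) -fndSome H2 fndSome.
  apply: IH => //; apply: env_ren_ext.
  exact: (env_ren_set (Var x) t (bij_inj fB) (bij_inj gB) H2).
- move=> G1 G2 G e1 e2 t k1 k2 He He2 cG f g G' fB gB HG.
  have [G1' [G2' [H1 H2 cG']]] := env_ext_comb fB gB cG HG.
  have [_ /texts_chanP[l1 [l2 [-> Hl1 Hl2]]] {}He] := typ_expr_ext fB gB He H1.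
  have [k1' E1] := use_ext_double Hl1; have [k2' E2] := use_ext_one Hl2.
  rewrite E1 E2 in He.
  by apply: typ_output He _ cG'; apply: typ_expr_ren He2 H2.
- move=> G P _ IH uG f g G' fB gB HG; apply: typ_repl; first exact: IH.
  move=> v; have [u ->] := ren_name_surj v fB gB; exact: oext_un (uG u) (HG u).
- move=> G1 G2 G P1 P2 _ IH1 _ IH2 cG f g G' fB gB HG.
  have [G1' [G2' [H1 /env_ren_ext H2 cG']]] := env_ext_comb fB gB cG HG.
  by apply: typ_par cG'; [apply: IH1|apply: IH2].
- move=> G a P t k aG _ IH f g G' fB gB HG.
  have [b []] := fresh_name (domf G' `|` fn (ren f g P)).
  rewrite inE negb_or => /andP[bG' bP] _.
  (* The bound channel [f a] is first replaced by the fresh [b], which lies outside [G']. *)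
  apply: typ_alpha (alpha_sym (alpha_ren_new (f a) bP)).
  apply: (typ_new (t := t) (k := k) bG'); rewrite /swap_chan ren_comp.
  apply: IH => //; first by apply: bij_comp fB; apply: inv_bij; apply: swapK.
  exact: env_ext_bind_chan (bij_inj fB) (bij_inj gB) aG bG' HG.
- move=> G1 G2 G e x P y Q t s He xG2 _ IHP yG2 _ IHQ cG f g G' fB gB HG.
  (* The summands are exchanged so that the branches take the growth: a grown scrutinee type would
     alter the types of the branch variables. *)
  have [G2' [G1' [H2 H1 /env_combC cG']]] :=
    env_ext_comb fB gB (env_combC cG) HG.
  have [n [_]] := fresh_name (domf G2' `|` fn (ren f g P) `|` fn (ren f g Q)).
  rewrite !inE !negb_or => /andP[/andP[nG' nP] nQ].
  apply: typ_alpha (alpha_sym (alpha_ren_inl _ (g x) _ _ nP)).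
  apply: typ_alpha (alpha_sym (alpha_ren_inr _ _ _ (g y) nQ)).
  apply: (typ_case (typ_expr_ren fB gB He H1) nG' _ nG' _ cG');
    rewrite /swap_var ren_comp.
    apply: IHP => //; first by apply: bij_comp gB; apply: inv_bij; apply: swapK.
    exact: env_ext_bind_var (bij_inj fB) (bij_inj gB) xG2 nG' H2.
  apply: IHQ => //; first by apply: bij_comp gB; apply: inv_bij; apply: swapK.
  exact: env_ext_bind_var (bij_inj fB) (bij_inj gB) yG2 nG' H2.
- move=> G P Q _ IH PQ f g G' fB gB HG.
  apply: typ_alpha (IH _ _ _ fB gB HG) _.
  exact: alpha_ren (bij_inj fB) (bij_inj gB) PQ.
Qed.

Lemma typ_proc_extend (G G' : env) P : typ_proc G P ->
  (forall u, oext G.[? u] G'.[? u]) -> typ_proc G' P.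
Proof.
move=> H HG; rewrite -[P]ren_id.
apply: (typ_proc_ext _ _ H); try by exists id.
by case=> n; apply: HG.
Qed.

(** * Soundness of constraint generation *)

Lemma fnd_app_env s D u : (app_env s D).[? u] = omap (app_t s) D.[? u].
Proof. by case: fndP => uD; [rewrite ffunE in_fnd|rewrite not_fnd]. Qed.

Lemma app_env_set s (D : tenv) u T :
  app_env s D.[u <- T] = (app_env s D).[u <- app_t s T].
Proof.
by apply/fmapP => v; rewrite fnd_app_env !fnd_set fnd_app_env; case: eqP.
Qed.

Definition satisfies s (C : constrs) : Prop := forall c, c \in C -> sat s c.

Lemma satisfiesU s C1 C2 :
  satisfies s (C1 `|` C2) <-> satisfies s C1 /\ satisfies s C2.
Proof.
split=> [H|[H1 H2] c]; last by rewrite inE => /orP[/H1|/H2].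
by split=> c cC; apply: H; rewrite inE cC ?orbT.
Qed.

Lemma satisfies1 s c : satisfies s [fset c] <-> sat s c.
Proof.
by split=> [H|H d]; [apply: H; rewrite inE|rewrite inE => /eqP->].
Qed.

Lemma satisfies2 s c d : satisfies s [fset c; d] <-> sat s c /\ sat s d.
Proof. by rewrite satisfiesU !satisfies1. Qed.

Lemma tenv_join_sound s X D1 D2 D C : tenv_join X D1 D2 D C -> satisfies s C ->
  env_comb (app_env s D1) (app_env s D2) (app_env s D).
Proof.
elim=> {X D1 D2 D C} [D1 D2 dis _ u|X D1 D2 D C u T S a _ IH _ _].
  rewrite !fnd_app_env fnd_cat; case: (fndP D2) => [u2|u2].
    by rewrite not_fnd // (fdisjointP_sym dis).
  by case: fndP.
move=> /satisfiesU[/IH{}IH /satisfies1 H] v.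
rewrite !app_env_set !fnd_set; case: eqP => _; last exact: IH.
by exists (app_t s (TVar a)).
Qed.

(** Equality of the instances lets [typ_case] type both branches over one environment. *)
Lemma tenv_meet_sound s D1 D2 D C : tenv_meet D1 D2 D C -> satisfies s C ->
  app_env s D1 = app_env s D /\ app_env s D2 = app_env s D.
Proof.
elim=> {D1 D2 D C} [//|D1 D2 D C u T S _ IH _ _].
move=> /satisfiesU[/IH[E1 E2] /satisfies1 /= H].
by rewrite !app_env_set E1 E2 H.
Qed.

Lemma gen_expr_sound s X e T D C : gen_expr X e T D C -> satisfies s C ->
  typ_expr (app_env s D) e (app_t s T).
Proof.
elim=> {X e T D C} /=.
- by move=> n _; apply: typ_const => u t; rewrite fnd_app_env fnd_fmap0.
- move=> u a _; rewrite app_env_set; apply: typ_name => [|v t].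
    by rewrite inE.
  by rewrite fnd_app_env fnd_fmap0.
- by move=> X e T D C a _ IH /IH; apply: typ_inl.
- by move=> X e T D C a _ IH /IH; apply: typ_inr.
- move=> X1 X2 X3 e1 e2 T1 T2 D1 D2 D C1 C2 C3 _ IH1 _ IH2 J.
  move=> /satisfiesU[/satisfiesU[/IH1 H1 /IH2 H2] /(tenv_join_sound J)].
  exact: typ_pair.
- move=> X e T D C a b _ IH /satisfiesU[/IH{}IH /satisfies2[/= E H]].
  by rewrite E in IH; apply: typ_fst IH H.
- move=> X e T D C a b _ IH /satisfiesU[/IH{}IH /satisfies2[/= E H]].
  by rewrite E in IH; apply: typ_snd IH H.
Qed.

Lemma gen_proc_sound s X P D C : gen_proc X P D C -> satisfies s C ->
  typ_proc (app_env s D) P.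
Proof.
elim=> {X P D C}.
- by move=> _; apply: typ_idle => u t; rewrite fnd_app_env fnd_fmap0.
- move=> X1 X2 X3 e x P T S D1 D2 D C1 C2 C3 r1 r2 He xD2 _ IH J.
  move=> /satisfiesU[/satisfiesU[/satisfiesU[S1 /IH{}IH] S3] /satisfies1 /= E].
  have := gen_expr_sound He S1; rewrite E => {}He.
  apply: typ_input He _ _ (tenv_join_sound J S3) => //.
  by rewrite -app_env_set.
- move=> X1 X2 X3 e f T S D1 D2 D C1 C2 C3 r1 r2 He Hf J.
  move=> /satisfiesU[/satisfiesU[/satisfiesU[S1 S2] S3] /satisfies1 /= E].
  have := gen_expr_sound He S1; rewrite E => {}He.
  exact: typ_output He (gen_expr_sound Hf S2) (tenv_join_sound J S3).
- move=> X X' P D D' C C' _ IH J /satisfiesU[/IH{}IH /(tenv_join_sound J) H].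
  (* The join of [D] with itself gives [T = t + t], which absorbs [t] by [comb_double]. *)
  have absD u t T : (app_env s D).[? u] = Some t ->
      (app_env s D').[? u] = Some T -> absorb t T.
    move=> Dt D'T; have := H u; rewrite Dt D'T.
    by case=> _ [<-] /comb_double.
  have noneD u : (app_env s D).[? u] = None -> (app_env s D').[? u] = None.
    by move=> DN; have := H u; rewrite DN.
  apply: typ_repl; last first.
    move=> u T D'T; case Dt: (app_env s D).[? u] => [t|].
      by case: (absD _ _ _ Dt D'T).
    by rewrite noneD in D'T.
  (* The body, typed with entries [t], is retyped with their doubles, which are unlimited as
     [typ_repl] demands. *)
  apply: (typ_proc_extend IH) => u.
  case Dt: (app_env s D).[? u] => [t|]; last by rewrite noneD.
  case D'T: (app_env s D').[? u] => [T|]; first by right; apply: absD Dt D'T.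
  by have := H u; rewrite Dt D'T => -[].
- move=> X1 X2 X3 P1 P2 D1 D2 D C1 C2 C3 _ IH1 _ IH2 J.
  move=> /satisfiesU[/satisfiesU[/IH1 H1 /IH2 H2] /(tenv_join_sound J)].
  exact: typ_par.
- move=> X a P T D C b r aD _ IH /satisfiesU[/IH{}IH /satisfies1 /= E].
  by rewrite app_env_set E in IH; apply: typ_new IH.
- move=> X1 Xl Xr X3 e x P y Q T Tl Tr D1 Dl Dr D2 D C1 Cl Cr C2 C3.
  move=> He xDl _ IHl yDr _ IHr M J.
  case/satisfiesU=> /satisfiesU[/satisfiesU[/satisfiesU[/satisfiesU[S1 S2] S3]
    /IHl{}IHl] /IHr{}IHr] /satisfies1 /= E.
  have [El Er] := tenv_meet_sound M S2.
  have := gen_expr_sound He S1; rewrite E => {}He.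
  (* The domain of [app_env s Dl] computes to that of [Dl], so freshness of the binder transfers
     along [El]. *)
  have xD2 : Var x \notin domf (app_env s D2) by rewrite -El.
  have yD2 : Var y \notin domf (app_env s D2) by rewrite -Er.
  rewrite app_env_set El in IHl; rewrite app_env_set Er in IHr.
  exact: typ_case He xD2 IHl yD2 IHr (tenv_join_sound J S3).
- move=> X P D C u a _ IH uD /satisfiesU[/IH{}IH /satisfies1 ua].
  (* Weakening adds an entry at a name without one; the constraint on the new type variable makes it
     unlimited. *)
  apply: (typ_proc_extend IH) => v; rewrite app_env_set [in X in oext _ X]fnd_set.
  case: eqP => [->|_]; last exact: oext_refl.
  by rewrite not_fnd.
- by move=> X P Q D C _ IH PQ /IH{}IH; apply: typ_alpha IH PQ.
Qed.

Theorem theorem4p2 (P : proc) (D : tenv) (C : constrs) (s : subst)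
    (hgen : generates P D C) (hsol : solution s C) (hcov : covers_env s D) :
  typ_proc (app_env s D) P.
Proof.
case: hgen => X [_ H]; apply: gen_proc_sound H _ => c /hsol[_]; exact.
Qed.
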